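(* Let $(\xi_n)_{n \in \mathbb{N}}$ be an exchangeable sequence of integrable real-valued random variables on a probability space $(\Omega, \mathscr{F}, \mathbb{P})$. Let $\mathscr{E}$ be its exchangeable $\sigma$-algebra and let $\mathscr{T}$ be its tail $\sigma$-algebra. Set $\xi := \mathbb{E}[\xi_1 \mid \mathscr{E}]$. Then the following statements are true: (1) For every subsequence $(n_k)_{k \in \mathbb{N}}$ of $\mathbb{N}$ and every permutation $\pi : \mathbb{N} \to \mathbb{N}$, the sequence $(\xi_{n_{\pi(k)}})_{k \in \mathbb{N}}$ is $\mathbb{P}$-almost surely Cesàro convergent to $\xi$. (2) For every permutation $\sigma : \mathbb{N} \to \mathbb{N}$ and every subsequence $(m_k)_{k \in \mathbb{N}}$ of $\mathbb{N}$, the sequence $(\xi_{\sigma(m_k)})_{k \in \mathbb{N}}$ is $\mathbb{P}$-almost surely Cesàro convergent to $\xi$. (3) $\mathbb{P}$-almost surely $\xi = \mathbb{E}[\xi_n \mid \mathscr{E}] = \mathbb{E}[\xi_n \mid \mathscr{T}]$ for each $n \in \mathbb{N}$.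
   Context: $\mathbb{N} = \{1,2,3,\ldots\}$. A subsequence $(n_k)_{k \in \mathbb{N}}$ of $\mathbb{N}$ means a strictly increasing sequence of elements of $\mathbb{N}$. A permutation $\pi : \mathbb{N} \to \mathbb{N}$ is a bijection; it is called finite if $\pi(n) = n$ for all but finitely many $n$. A sequence $(\xi_n)_{n \in \mathbb{N}}$ of random variables is exchangeable if for every finite permutation $\pi : \mathbb{N} \to \mathbb{N}$ the sequences $(\xi_n)_{n \in \mathbb{N}}$ and $(\xi_{\pi(n)})_{n \in \mathbb{N}}$ have the same distribution under $\mathbb{P}$; equivalently, for all $k \in \mathbb{N}$, all pairwise different $n_1,\ldots,n_k \in \mathbb{N}$ and all pairwise different $m_1,\ldots,m_k \in \mathbb{N}$, the random vectors $(\xi_{n_1},\ldots,\xi_{n_k})$ and $(\xi_{m_1},\ldots,\xi_{m_k})$ have the same distribution. The exchangeable $\sigma$-algebra $\mathscr{E}$ of $(\xi_n)_{n \in \mathbb{N}}$ is the $\sigma$-algebra of all events $\{(\xi_n)_{n \in \mathbb{N}} \in A\}$, where $A \subset \mathbb{R}^{\mathbb{N}}$ is a set in the product Borel $\sigma$-algebra that is invariant under all finite permutations of the coordinates. The tail $\sigma$-algebra is $\mathscr{T} = \bigcap_{n \in \mathbb{N}} \sigma(\xi_n, \xi_{n+1}, \ldots)$. A sequence $(\eta_k)_{k \in \mathbb{N}}$ of random variables is $\mathbb{P}$-almost surely Cesàro convergent to $\eta$ if $\frac{1}{n} \sum_{k=1}^n \eta_k \to \eta$ $\mathbb{P}$-almost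 surely as $n \to \infty$. *)

(* Defs.v *)
From HB Require Import structures.
From mathcomp Require Import all_boot all_order all_algebra.
From mathcomp Require Import all_classical all_reals all_analysis.
From mathcomp Require Import measurable_realfun.

Set Implicit Arguments.
Unset Strict Implicit.
Unset Printing Implicit Defensive.

Import Order.TTheory GRing.Theory Num.Theory.
Import numFieldNormedType.Exports.

Local Open Scope classical_set_scope.
Local Open Scope ring_scope.

(* Sequences are indexed by [nat], so [xi 0] is the first variable, and the
   library's [arithmetic_mean u n] averages the first [n.+1] terms of [u]. *)

Definition finite_perm (pi : nat -> nat) : Prop :=
  bijective pi /\ finite_set [set n | pi n <> n].

Definition sigma_generated (U : Type) (R : realType) (J : set nat)
    (X : nat -> U -> R) : set (set U) :=
  <<s \bigcup_(j in J) preimage_set_system setT (X j) measurable >>.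

Definition seq_borel (R : realType) : set (set (nat -> R)) :=
  sigma_generated setT (fun (n : nat) (x : nat -> R) => x n).

Definition perm_invariant (R : realType) (A : set (nat -> R)) : Prop :=
  forall pi, finite_perm pi -> (fun x : nat -> R => x \o pi) @^-1` A = A.

Section Sequences.
Context d (T : measurableType d) (R : realType) (P : probability T R).
Implicit Types (xi : nat -> {RV P >-> R}) (G : set (set T)) (X Y : T -> R).

Definition sample_path xi : T -> nat -> R := fun w n => xi n w.

Definition exchangeable xi : Prop :=
  forall pi, finite_perm pi -> forall A, seq_borel A ->
    P (sample_path xi @^-1` A) = P (sample_path (xi \o pi) @^-1` A).

Definition exchangeable_sigma xi : set (set T) :=
  [set sample_path xi @^-1` A |
    A in [set A | seq_borel A /\ perm_invariant A]].

Definition tail_sigma xi : set (set T) :=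
  \bigcap_(n in [set: nat]) sigma_generated [set k | (n <= k)%N] xi.

(* [Y] is a version of E[X | G]; [G] is meant to be a sub-sigma-algebra *)
Definition is_cond_exp G X Y : Prop :=
  [/\ forall B, measurable B -> G (Y @^-1` B),
      P.-integrable setT (EFin \o Y) &
      forall A, G A ->
        (\int[P]_(w in A) (Y w)%:E = \int[P]_(w in A) (X w)%:E)%E].

Definition as_cesaro_cvg (eta : nat -> T -> R) (l : T -> R) : Prop :=
  {ae P, forall w, arithmetic_mean (eta ^~ w) @ \oo --> l w}.

End Sequences.

(* The next two sections show that the versions quantified over through
   [is_cond_exp] exist, so that such a quantification is never vacuous. *)

Section CondExpExistence.
Context d (T : measurableType d) (R : realType) (P : probability T R).

Lemma is_cond_exp_exists (G : set (set T)) (X : T -> R) :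
  sigma_algebra setT G -> G `<=` measurable ->
  P.-integrable setT (EFin \o X) -> exists Y, is_cond_exp P G X Y.
Proof.
move=> sG Gm iX.
have mX : measurable_fun [set: T] X.
  exact/measurable_EFinP/(measurable_int _ iX).
have mGE : @measurable _ (g_sigma_algebraType G) = G.
  exact: measurable_g_measurableTypeE.
pose f : T -> g_sigma_algebraType G := id.
have mf : measurable_fun setT f.
  by move=> _ A; rewrite setTI mGE; exact: Gm.
pose f_mixin := isMeasurableFun.Build _ _ _ _ _ mf.
pose F : {mfun T >-> g_sigma_algebraType G} := HB.pack f f_mixin.
pose mu : probability (g_sigma_algebraType G) R := distribution P F.
pose nu : {charge set T -> \bar R} := induced_charge iX.
pose nuG0 : {charge set g_sigma_algebraType G -> \bar R} := pushforward nu F.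
pose nuG := nuG0 mf.
have numu : nuG `<< mu.
  apply/null_content_dominatesP => A mA muA.
  rewrite /nuG/= /pushforward/= /induced_charge.
  apply: null_set_integral => //; first by move: mA; rewrite mGE; exact: Gm.
  by apply/measurable_EFinP; exact: measurable_funS mX.
pose g := fun x => fine (Radon_Nikodym nuG mu x).
have gE x : (g x)%:E = Radon_Nikodym nuG mu x.
  by rewrite fineK//; exact: Radon_Nikodym_fin_num.
have igG : mu.-integrable setT (EFin \o g).
  rewrite (_ : EFin \o g = Radon_Nikodym nuG mu); last exact/funext.
  exact: Radon_Nikodym_integrable.
have mgG : measurable_fun [set: g_sigma_algebraType G] g.
  by apply/measurable_EFinP; apply: measurable_int igG.
have ig : P.-integrable setT (EFin \o g).
  apply/integrableP; split.
    have -> : EFin \o g = (EFin \o (g : g_sigma_algebraType G -> R)) \o f by [].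
    by apply: measurableT_comp => //; exact/measurable_EFinP.
  move/integrableP : igG => [_].
  rewrite ge0_integral_pushforward//.
  by apply/measurable_EFinP; exact: measurableT_comp.
exists g; split => //.
- by move=> B mB; have := mgG measurableT _ mB; rewrite setTI mGE.
- move=> A GA.
  have mA : @measurable _ (g_sigma_algebraType G) A by rewrite mGE.
  rewrite -[RHS]/(nuG A) (Radon_Nikodym_integral numu)//.
  under [RHS]eq_integral do rewrite -gE.
  rewrite integral_pushforward//; first exact/measurable_EFinP.
  by apply: (integrableS measurableT) ig => //; exact: Gm.
Qed.

End CondExpExistence.

Section SigmaAlgebras.
Context d (T : measurableType d) (R : realType) (P : probability T R).
Variable xi : nat -> {RV P >-> R}.

Lemma sigma_generated_sub (J : set nat) : sigma_generated J xi `<=` measurable.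
Proof.
apply: smallest_sub; first exact: sigma_algebra_measurable.
by move=> _ [j _ [B mB <-]]; rewrite setTI; exact: measurable_funPTI.
Qed.

Lemma tail_sigma_algebra : sigma_algebra setT (tail_sigma xi).
Proof.
by apply: sigma_algebra_bigcap => n _; exact: smallest_sigma_algebra.
Qed.

Lemma tail_sigma_sub : tail_sigma xi `<=` measurable.
Proof. by move=> A /(_ 0 I); exact: sigma_generated_sub. Qed.

Lemma sample_path_measurable A : seq_borel A ->
  measurable (sample_path xi @^-1` A).
Proof.
move: A; apply: smallest_sub; first split.
- by rewrite preimage_set0.
- by move=> A mA; rewrite setTD preimage_setC; exact: measurableC.
- by move=> F mF; rewrite preimage_bigcup; exact: bigcup_measurable.
- by move=> _ [n _ [B mB <-]]; rewrite setTI; apply: measurable_funPTI.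
Qed.

Lemma exchangeable_sigma_sub : exchangeable_sigma xi `<=` measurable.
Proof. by move=> _ [A [+ _] <-]; exact: sample_path_measurable. Qed.

Lemma exchangeable_sigma_algebra : sigma_algebra setT (exchangeable_sigma xi).
Proof.
have [b0 bC bU] : sigma_algebra setT (@seq_borel R).
  exact: smallest_sigma_algebra.
split.
- exists set0; last by rewrite preimage_set0.
  by split => // pi _; rewrite preimage_set0.
- move=> _ [A [bA iA] <-]; exists (~` A); last by rewrite setTD preimage_setC.
  split=> [|pi /iA ipi]; first by rewrite -setTD; exact: bC.
  by rewrite -{2}ipi preimage_setC.
- move=> F /= /(_ _)/cid2 h.
  exists (\bigcup_k s2val (h k)).
    split; first by apply: bU => k; have [] := s2valP (h k).
    move=> pi hpi; rewrite preimage_bigcup; apply: eq_bigcupr => k _.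
    by have [_ iA] := s2valP (h k); exact: iA.
  rewrite preimage_bigcup; apply: eq_bigcupr => k _.
  exact: s2valP' (h k).
Qed.

End SigmaAlgebras.

(* Main.v *)
Require Import Defs.
From HB Require Import structures.
From mathcomp Require Import all_boot all_order all_algebra.
From mathcomp Require Import all_classical all_reals all_analysis.
From mathcomp Require Import measurable_realfun.
From mathcomp Require Import lra.

(** The theorem is one strong law, [exchangeable_strong_law]: if a sigma-algebra
    [G] lies between the tail and the exchangeable sigma-algebras, if [Y] is a
    version of the conditional expectation of some [xi j] given [G], and if
    [iota] is injective, then the means of [xi (iota 0)], [xi (iota 1)], etc.
    converge to [Y] almost surely. Both [n \o pi] and [sigma \o m] are
    injective, so (1) and (2) are the case where [G] is the exchangeable
    sigma-algebra. For (3), the cases where [G] is the exchangeable and the tail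
    sigma-algebra identify [xibar], [Y] and [Z] as limits of the same means.

    The strong law is proved as Garsia proves the ergodic theorem. For [a < b],
    consider the event [B] that [Y < a] and the means have limit superior above
    [b]. The second condition is a tail event, because [iota] is injective;
    hence [B] is in [G], and it is exchangeable because tail events are
    ([tail_sigma_exchangeable]). On an exchangeable event the law of the path is
    invariant under finite permutations ([exchangeable_integral]), and a finite
    permutation can shift the first coordinates chosen by [iota]
    ([finite_perm_interpolation]). This is the stationarity that Garsia's
    maximal inequality requires ([garsia_inequality]), which gives
    [0 <= \int_B (xi (iota 0) - b)]. By exchangeability and the definition of
    [Y], the integral of [xi (iota 0)] over [B] is that of [Y], which is at most
    [a * P B]. So [P B = 0] ([crossing_null]). Rational [a] and [b] suffice to
    bound the limit superior by [Y], and the same argument applied to [- xi]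
    bounds the limit inferior ([mean_cvg]). *)

Set Implicit Arguments.
Unset Strict Implicit.
Unset Printing Implicit Defensive.

Import Order.TTheory GRing.Theory Num.Theory.
Import numFieldNormedType.Exports.

Local Open Scope classical_set_scope.
Local Open Scope ring_scope.

(** * Finite permutations *)

Definition transpose_nat (a b k : nat) : nat :=
  if k == a then b else if k == b then a else k.

Lemma transpose_natK a b : involutive (transpose_nat a b).
Proof.
move=> k; rewrite /transpose_nat; case: (eqVneq k a) => [->|ka].
  by case: (eqVneq b a) => [->|_]; rewrite ?eqxx.
by case: (eqVneq k b) => [->|kb]; rewrite ?eqxx // (negbTE ka) (negbTE kb).
Qed.

Lemma finite_perm_transpose a b : finite_perm (transpose_nat a b).
Proof.
split; first exact: inv_bij (transpose_natK a b).
apply: sub_finite_set (finite_set2 a b) => k /= kab.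
apply: contrapT => /not_orP[/eqP/negbTE ka /eqP/negbTE kb].
by apply: kab; rewrite /transpose_nat ka kb.
Qed.

Lemma finite_perm_comp p q : finite_perm p -> finite_perm q ->
  finite_perm (p \o q).
Proof.
move=> [bp fp] [bq fq]; split; first exact: bij_comp.
apply: (@sub_finite_set _ _ ([set n | p n <> n] `|` [set n | q n <> n])).
  move=> n /=; apply: contra_notP => /not_orP[/contrapT pn /contrapT qn].
  by rewrite qn.
by rewrite finite_setU.
Qed.

(** Transpositions suffice: once the first [n] targets are right, exchanging
    the current image of [a n] with [b n] moves none of them, because [a] and
    [b] are injective. *)
Lemma finite_perm_interpolation (a b : nat -> nat) :
  injective a -> injective b -> forall n, exists p, finite_perm p /\
    forall i, (i < n)%N -> p (a i) = b i.
Proof.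
move=> ia ib; elim=> [|n [p [fp pE]]].
  exists id; split=> //; split; first by exists id.
  by apply: (@sub_finite_set _ _ set0) => // x /=.
exists (transpose_nat (p (a n)) (b n) \o p); split.
  by apply: finite_perm_comp => //; exact: finite_perm_transpose.
move=> i; rewrite ltnS leq_eqVlt /= /transpose_nat => /predU1P[->|lin].
  by rewrite eqxx.
case: eqP => [/(bij_inj fp.1)/ia ein|_]; first by rewrite ein ltnn in lin.
by rewrite pE//; case: eqP => // /ib ein; rewrite ein ltnn in lin.
Qed.

Lemma finite_set_nat_bounded (A : set nat) : finite_set A ->
  exists N, forall n, (N <= n)%N -> ~ A n.
Proof.
move=> /finite_seqP[s ->]; exists (\max_(i <- s) i).+1 => n ltn /= ns.
by have := leq_bigmax_seq (P := xpredT) (F := id) n ns isT; rewrite leqNgt ltn.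
Qed.

(** * Paths, tail events and exchangeable events *)

Definition coordinate (R : realType) (n : nat) (x : nat -> R) : R := x n.

(** The measurable sets of this type are, by conversion, those of
    [seq_borel R]. *)
Definition path_space (R : realType) := g_sigma_algebraType
  (\bigcup_(j in setT) preimage_set_system setT (@coordinate R j) measurable).

HB.instance Definition _ (R : realType) := Measurable.on (path_space R).

Lemma measurable_coordinate (R : realType) n :
  measurable_fun setT (@coordinate R n : path_space R -> R).
Proof.
move=> _ B mB; apply: sub_gen_smallest.
by exists n => //; exists B.
Qed.

Section SigmaGenerated.
Variable R : realType.

Lemma sigma_generated_determined (J : set nat) (A : set (nat -> R)) :
  sigma_generated J (@coordinate R) A ->
  forall x y, {in J, x =1 y} -> A x -> A y.
Proof.
move=> JA; suff h x y : {in J, x =1 y} -> A x <-> A y.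
  by move=> x y /h[].
move=> xy; move: A JA; apply: smallest_sub.
  split=> [//|A Axy|F Fxy].
    by rewrite setTD; split=> Ax; [move/(Axy.2)|move/(Axy.1)].
  by split=> -[k _ Fk]; exists k => //; apply/Fxy.
move=> _ [j Jj [B mB <-]]; rewrite setTI /coordinate /=.
by rewrite xy// inE.
Qed.

Lemma sigma_generatedS (U : Type) (J K : set nat) (X : nat -> U -> R) :
  J `<=` K -> sigma_generated J X `<=` sigma_generated K X.
Proof. by move=> JK; apply: sub_sigma_algebra2; exact: bigcup_subset. Qed.

End SigmaGenerated.

Section PathSigma.
Context d (T : measurableType d) (R : realType) (P : probability T R).
Variable xi : nat -> {RV P >-> R}.

Lemma sigma_generated_pathP (J : set nat) (A : set T) :
  sigma_generated J xi A ->
  exists2 B, sigma_generated J (@coordinate R) B & sample_path xi @^-1` B = A.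
Proof.
have sJ : sigma_algebra [set: nat -> R] (sigma_generated J (@coordinate R)).
  exact: smallest_sigma_algebra.
have : sigma_generated J xi `<=`
    preimage_set_system setT (sample_path xi)
      (sigma_generated J (@coordinate R)).
  apply: smallest_sub; first exact: sigma_algebra_preimage.
  move=> _ [j Jj [B mB <-]]; exists (@coordinate R j @^-1` B) => //.
  by apply: sub_gen_smallest; exists j => //; exists B => //; rewrite setTI.
by move=> h /h[B sB <-]; exists B; rewrite ?setTI.
Qed.

(** A tail event is, for each [m], described by the coordinates from [m] on;
    these descriptions may differ, but their limit superior describes the event
    using arbitrarily late coordinates only, so that no finite permutation
    changes it. *)
Lemma tail_sigma_exchangeable : tail_sigma xi `<=` exchangeable_sigma xi.
Proof.
move=> A tA.
have /choice[B BP] m : exists B,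
    sigma_generated [set k | (m <= k)%N] (@coordinate R) B /\
    sample_path xi @^-1` B = A.
  by have [B sB <-] := sigma_generated_pathP (tA m I); exists B.
have borelB m : seq_borel (B m).
  exact: (sigma_generatedS (@subsetT _ _) (BP m).1).
exists (lim_sup_set B); last first.
  rewrite /lim_sup_set preimage_bigcap.
  apply/seteqP; split=> [w /(_ 0%N I)[k _]|w Aw m _].
    by rewrite -(BP k).2.
  exists m; first exact: leqnn.
  by rewrite -[B m _]/((sample_path xi @^-1` B m) w) (BP m).2.
split.
  apply: (@bigcapT_measurable _ (path_space R)) => m.
  by apply: (@bigcup_measurable _ (path_space R)) => j _; exact: borelB.
move=> p [_ /finite_set_nat_bounded[N pN]].
have sub x y : (forall k, (N <= k)%N -> x k = y k) ->
    lim_sup_set B x -> lim_sup_set B y.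
  move=> xy Bx m _; have [j /= mj Bj] := Bx (maxn m N) I.
  exists j; first by rewrite /= (leq_trans _ mj)// leq_maxl.
  apply: (sigma_generated_determined (BP j).1) Bj => k; rewrite inE /= => jk.
  by apply: xy; rewrite (leq_trans _ jk)// (leq_trans _ mj)// leq_maxr.
by apply/seteqP; split=> x; apply: sub => k /pN /contrapT /= ->.
Qed.

End PathSigma.

(** * Invariance of integrals over exchangeable events *)

Section ExchangeableIntegral.
Context d (T : measurableType d) (R : realType) (P : probability T R).
Variable xi : nat -> {RV P >-> R}.

Lemma measurable_sample_path (zeta : nat -> {RV P >-> R}) :
  measurable_fun setT (sample_path zeta : T -> path_space R).
Proof. by move=> _ A mA; rewrite setTI; exact: sample_path_measurable. Qed.

Local Open Scope ereal_scope.

(** On an event of [exchangeable_sigma xi] the paths of [xi] and of [xi \o p]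
    run through the same invariant set, so that both sides are the integral
    over this set against the common law of the two paths. *)
Lemma exchangeable_integral (f : path_space R -> R) p B :
  exchangeable xi -> finite_perm p -> exchangeable_sigma xi B ->
  measurable_fun setT f ->
  P.-integrable B (EFin \o f \o sample_path xi) ->
  P.-integrable B (EFin \o f \o sample_path (xi \o p)) ->
  \int[P]_(w in B) (f (sample_path (xi \o p) w))%:E =
  \int[P]_(w in B) (f (sample_path xi w))%:E.
Proof.
move=> exch fp [A [bA iA] <-{B}] mf ixi ixip.
have iAp : sample_path xi @^-1` A = sample_path (xi \o p) @^-1` A.
  by rewrite -{1}(iA p fp).
pose path_mixin zeta := isMeasurableFun.Build _ _ _ _ _
  (measurable_sample_path zeta).
pose path zeta : {mfun T >-> path_space R} :=
  HB.pack (sample_path zeta : T -> path_space R) (path_mixin zeta).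
have pushE zeta : P.-integrable (sample_path zeta @^-1` A)
      (EFin \o f \o sample_path zeta) ->
    \int[P]_(w in sample_path zeta @^-1` A) (f (sample_path zeta w))%:E =
    \int[distribution P (path zeta)]_(x in A) (f x)%:E.
  move=> i; rewrite integral_pushforward//.
  exact/measurable_EFinP.
rewrite {1}iAp [LHS]pushE -?iAp// [RHS]pushE//.
apply: eq_measure_integral => C mC _.
by rewrite /distribution /pushforward/=; apply/esym/exch.
Qed.

End ExchangeableIntegral.

(** * Garsia's maximal inequality *)

(** [running_max n y] is the maximum of the partial sums of [y] of length at
    most [n], the empty sum included. Peeling off the first term instead of the
    last one makes Garsia's inequality immediate. *)
Fixpoint running_max (R : realType) n (y : nat -> R) : R :=
  if n is m.+1 then Num.max (y 0%N + running_max m (y \o succn)) 0 else 0.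

Section RunningMax.
Variable R : realType.
Implicit Types y z : nat -> R.

Lemma running_max_ge0 n y : 0 <= running_max n y.
Proof. by case: n => //= n; rewrite le_max lexx orbT. Qed.

Lemma eq_running_max n y z : (forall i, (i < n)%N -> y i = z i) ->
  running_max n y = running_max n z.
Proof.
elim: n y z => //= n IH y z yz; rewrite yz// (IH _ (z \o succn))// => i lin.
by rewrite /= yz.
Qed.

Lemma le_running_maxS n y : running_max n y <= running_max n.+1 y.
Proof.
elim: n y => [|n IH] y; first exact: running_max_ge0.
rewrite [leLHS]/= [leRHS]/=; apply: le_max2 => //.
by rewrite lerD2l; exact: IH.
Qed.

Lemma le_running_max y :
  {homo (fun n => running_max n y) : m n / (m <= n)%N >-> m <= n}.
Proof.
by apply: homo_leq => // [? ? ?|n]; [exact: le_trans|exact: le_running_maxS].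
Qed.

Lemma sum_le_running_max n y : \sum_(0 <= i < n) y i <= running_max n y.
Proof.
elim: n y => [|n IH] y; first by rewrite big_nil.
rewrite big_nat_recl//= le_max lerD2l; apply/orP; left; exact: IH.
Qed.

(** If [running_max n.+1 y] is positive, it equals
    [y 0 + running_max n (y \o succn)], and it is at least [running_max n y].
    Otherwise [running_max n y] vanishes, and so does the right-hand side. *)
Lemma first_term_ge y n :
  running_max n y - running_max n (y \o succn) <=
  (0 < running_max n.+1 y)%R%:R * y 0%N.
Proof.
have := le_running_maxS n y; have := running_max_ge0 n (y \o succn).
case: ltP => [|le0 ge0 h].
  rewrite /= lt_max ltxx orbF => h; rewrite max_l; last exact: ltW.
  by rewrite mul1r => ? ?; rewrite lerBlDr.
by rewrite mul0r subr_le0 (le_trans h)// (le_trans le0).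
Qed.

End RunningMax.

Section Garsia.
Context d (T : measurableType d) (R : realType).

Lemma measurable_running_max (D : set T) n (y : nat -> T -> R) :
  (forall i, measurable_fun D (y i)) ->
  measurable_fun D (fun w => running_max n (y ^~ w)).
Proof.
elim: n y => [|n IH] y my /=; first exact: measurable_cst.
apply: measurable_maxr => //; apply: measurable_funD => //.
by apply: (IH (fun i => y i.+1)) => i.
Qed.

Local Open Scope ereal_scope.

Variable mu : {measure set T -> \bar R}.

Lemma integrable_running_max (D : set T) n (y : nat -> T -> R) :
  measurable D -> (forall i, mu.-integrable D (EFin \o y i)) ->
  mu.-integrable D (fun w => (running_max n (y ^~ w))%:E).
Proof.
move=> mD; elim: n y => [|n IH] y iy /=; first exact: integrable0.
rewrite [X in _.-integrable _ X](_ : _ = (fun w => (y 0%N w)%:E +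
    (running_max n (fun i => y i.+1 w))%:E)^\+); last first.
  by apply/funext => w; rewrite EFin_max EFinD funeposE.
apply: integrable_funepos => //.
apply: integrableD => //; first exact: iy.
by apply: (IH (fun i => y i.+1)) => i; exact: iy.
Qed.

(** Wherever [0 < running_max n.+1 y], the first term is at least the drop of
    [running_max n] caused by a shift. This drop integrates to zero, and
    these places exhaust [B] as [n] grows. *)
Lemma garsia_inequality (B : set T) (y : nat -> T -> R) :
  measurable B -> (forall i, mu.-integrable B (EFin \o y i)) ->
  (forall n, \int[mu]_(w in B) (running_max n (fun i => y i.+1 w))%:E =
             \int[mu]_(w in B) (running_max n (y ^~ w))%:E) ->
  (forall w, B w -> exists n, (0 < \sum_(0 <= i < n) y i w)%R) ->
  0 <= \int[mu]_(w in B) (y 0%N w)%:E.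
Proof.
move=> mB iy shift pos.
have my i : measurable_fun B (y i).
  exact/measurable_EFinP/(measurable_int _ (iy i)).
pose g n w := ((0 < running_max n.+1 (y ^~ w))%R%:R * y 0%N w)%R.
have mg n : measurable_fun B (g n).
  apply: measurable_funM => //.
  apply: (@measurableT_comp _ _ _ _ bool R (fun b : bool => b%:R : R)) => //.
  by apply: measurable_fun_ltr => //; exact: measurable_running_max.
have gy n w : (`|g n w| <= `|y 0%N w|)%R.
  by rewrite /g; case: ltP => _; rewrite ?mul1r ?mul0r ?normr0.
have ig n : mu.-integrable B (EFin \o g n).
  apply: le_integrable (iy 0%N) => //; first exact/measurable_EFinP.
  by move=> w _; rewrite lee_fin.
have g_ge0 n : 0 <= \int[mu]_(w in B) (g n w)%:E.
  have iM := integrable_running_max n mB iy.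
  have iS := integrable_running_max n mB (fun i => iy i.+1).
  have <- : \int[mu]_(w in B) ((running_max n (y ^~ w))%:E -
      (running_max n (fun i => y i.+1 w))%:E) = 0.
    by rewrite integralB// shift subee//; exact: integrable_fin_num.
  apply: le_integral => //; [exact: integrableB|exact: ig|].
  by move=> w _; rewrite -EFinB lee_fin first_term_ge.
have cvg_g : (\int[mu]_(w in B) (g n w)%:E) @[n --> \oo] -->
    \int[mu]_(w in B) (y 0%N w)%:E.
  apply: (@dominated_cvg _ _ _ mu B mB (fun n w => (g n w)%:E) _
    (fun w => `|(y 0%N w)%:E|)) => //.
  - by move=> n; exact/measurable_EFinP.
  - move=> w Bw; apply: cvg_near_cst.
    have [N N_gt0] := pos w Bw.
    exists N => // n /= Nn; rewrite /g (_ : (_ < _)%R) ?mul1r//.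
    rewrite (lt_le_trans N_gt0)// (le_trans (sum_le_running_max _ _))//.
    by apply: le_running_max; exact: leqW.
  - exact: integrable_abse (iy 0%N).
  - by move=> n w _; rewrite lee_fin.
rewrite -(cvg_lim _ cvg_g)//.
apply: lime_ge; first by apply/cvg_ex; eexists; exact: cvg_g.
exact: nearW.
Qed.

End Garsia.

(** * Means *)

(** This says that the limit superior of [S n / n.+1] exceeds [b]. The margin
    [k.+1%:R^-1] makes the property insensitive to bounded changes of [S]. *)
Definition limsup_mean_gt (R : realType) (b : R) (S : nat -> R) : Prop :=
  exists k, forall N, exists2 n, (N <= n)%N & n.+1%:R * (b + k.+1%:R^-1) < S n.

Section LimsupMean.
Variable R : realType.
Implicit Types (b c : R) (S u : nat -> R).

Lemma limsup_mean_gt_bounded b c S1 S2 m :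
  (forall n, (m <= n)%N -> S1 n <= S2 n + c) ->
  limsup_mean_gt b S1 -> limsup_mean_gt b S2.
Proof.
move=> S12 [k kS1]; exists k.*2.+1 => N.
pose K : R := k.*2.+2%:R.
have K_gt0 : 0 < K by rewrite ltr0n.
have [n] := kS1 (maxn (maxn m N) (Num.bound `|c * K|)).
rewrite !geq_max -andbA => /and3P[mn Nn cn] S1n.
exists n => //; have := S12 n mn.
(* The two margins differ by [K^-1], which is worth more than [c] after
   multiplication by [n.+1]. *)
have c_le : c <= n.+1%:R * K^-1.
  rewrite ler_pdivlMr// (le_trans (ler_norm _))// ltW//.
  rewrite (lt_le_trans (archi_boundP (normr_ge0 _)))// ler_nat.
  exact: leqW.
have kE : k.+1%:R^-1 = K^-1 + K^-1 :> R.
  have KE : K = 2 * k.+1%:R by rewrite /K -natrM mul2n.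
  by rewrite KE invfM; move: (_.+1%:R^-1) => q; lra.
move: S1n c_le; rewrite kE -/K !mulrDr.
by move: (_ * b) (_ / K) => x z; lra.
Qed.

(** Dropping the first [m] terms changes the sums by a constant: this is why
    the condition defines a tail event. *)
Lemma limsup_mean_gt_tail b u m :
  limsup_mean_gt b (fun n => \sum_(0 <= i < n.+1) u i) <->
  limsup_mean_gt b (fun n => \sum_(m <= i < n.+1) u i).
Proof.
have split n : (m <= n)%N -> \sum_(0 <= i < n.+1) u i =
    \sum_(m <= i < n.+1) u i + \sum_(0 <= i < m) u i.
  by move=> mn; rewrite addrC -big_cat_nat ?leqW.
split; apply: (@limsup_mean_gt_bounded _ _ _ _ m) => n /split.
  by move=> ->; exact: lexx.
by move=> /eqP; rewrite -subr_eq => /eqP <-.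
Qed.

(** The sign [s] turns a bound from above for [- u] into one from below for [u].
    Thresholds are rational so that, applied to random sequences, the
    hypothesis excludes only countably many events. *)
Lemma mean_cvg u (l : R) :
  (forall (s : bool) (a b : rat), (a < b)%R -> (-1) ^+ s * l < ratr a ->
    ~ limsup_mean_gt (ratr b)
      (fun n => \sum_(0 <= i < n.+1) (-1) ^+ s * u i)) ->
  arithmetic_mean u @ \oo --> l.
Proof.
move=> H; apply/cvgrPdist_lt => e e_gt0.
have half (s : bool) :
    \forall n \near \oo, (-1) ^+ s * (arithmetic_mean u n - l) < e.
  set l' := (-1) ^+ s * l.
  have /rat_in_itvoo[b] : l' < l' + e by rewrite ltrDl.
  rewrite in_itv/= => /andP[lb be].
  have /rat_in_itvoo[a] := lb.
  rewrite in_itv/= => /andP[la ab].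
  rewrite ltr_rat in ab.
  have [k kbe] := ltr_add_invr be.
  have /existsNP[N HN] : ~ forall N, exists2 n, (N <= n)%N &
      n.+1%:R * (ratr b + k.+1%:R^-1) < \sum_(0 <= i < n.+1) (-1) ^+ s * u i.
    by move=> h; apply: (H s a b ab la); exists k.
  exists N => // n /= Nn.
  have : \sum_(0 <= i < n.+1) (-1) ^+ s * u i <=
      n.+1%:R * (ratr b + k.+1%:R^-1).
    by rewrite leNgt; apply/negP => ?; apply: HN; exists n.
  rewrite -mulr_sumr -ler_pdivrMl ?ltr0n// mulrCA => le_mean.
  rewrite mulrBr ltrBlDl.
  by apply: le_lt_trans kbe.
near=> n.
have below : (-1) ^+ false * (arithmetic_mean u n - l) < e.
  by near: n; exact: half.
have above : (-1) ^+ true * (arithmetic_mean u n - l) < e.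
  by near: n; exact: half.
rewrite distrC real_lter_norml ?num_real//.
by move: below above; rewrite expr0 expr1; lra.
Unshelve. all: by end_near.
Qed.

End LimsupMean.

(** * The strong law *)

Section StrongLaw.
Context d (T : measurableType d) (R : realType) (P : probability T R).
Variable xi : nat -> {RV P >-> R}.

(** An injective [iota] takes only finitely many values below a given [m], so
    that dropping finitely many terms leaves variables of index at least [m]. *)
Lemma tail_limsup_mean_gt (iota : nat -> nat) (c b : R) : injective iota ->
  tail_sigma xi [set w |
    limsup_mean_gt b (fun n => \sum_(0 <= i < n.+1) c * xi (iota i) w)].
Proof.
move=> iota_inj m _.
have : finite_set (iota @^-1` `I_m).
  by apply: finite_preimage (finite_II m) => i j _ _; exact: iota_inj.
move=> /finite_set_nat_bounded[m' m'P].
pose S := g_sigma_algebraType (\bigcup_(j in [set k | (m <= k)%N])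
  preimage_set_system setT (xi j) measurable).
have mxi j : (m <= j)%N -> measurable_fun setT (xi j : S -> R).
  by move=> mj _ B mB; apply: sub_gen_smallest; exists j => //; exists B.
have -> : [set w |
    limsup_mean_gt b (fun n => \sum_(0 <= i < n.+1) c * xi (iota i) w)] =
  \bigcup_k \bigcap_N \bigcup_(n >= N) [set w |
    n.+1%:R * (b + k.+1%:R^-1) < \sum_(m' <= i < n.+1) c * xi (iota i) w].
  apply/seteqP; split=> w /=.
    move=> /(limsup_mean_gt_tail _ _ m')[k kP]; exists k => // N _.
    by have [n Nn ltn] := kP N; exists n.
  move=> [k _ kP]; apply/(limsup_mean_gt_tail _ _ m'); exists k => N.
  by have [n Nn ltn] := kP N I; exists n.
apply: (@bigcup_measurable _ S) => k _; apply: (@bigcapT_measurable _ S) => N.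
apply: (@bigcup_measurable _ S) => n _.
(* [maxn m' i] is [i] in the range of summation; with it, every summand, for
   whatever [i], involves only a variable of index at least [m]. *)
have msum : measurable_fun setT
    (fun w : S => \sum_(m' <= i < n.+1) c * xi (iota (maxn m' i)) w).
  apply: measurable_sum => i; apply: measurable_funM => //; apply: mxi.
  by rewrite leqNgt; apply/negP; apply: m'P; rewrite leq_maxl.
have := measurable_fun_ltr
  (@measurable_cst _ _ S _ setT (n.+1%:R * (b + k.+1%:R^-1))) msum.
move=> /(_ measurableT [set true] I).
rewrite setTI; congr (@measurable _ S _); apply/seteqP.
have sumE w : \sum_(m' <= i < n.+1) c * xi (iota (maxn m' i)) w =
    \sum_(m' <= i < n.+1) c * xi (iota i) w.
  by apply: eq_big_nat => i /andP[m'i _]; rewrite (maxn_idPr m'i).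
by split=> w /=; rewrite sumE.
Qed.

Hypothesis xi_exch : exchangeable xi.
Hypothesis xi_int : forall n, P.-integrable setT (EFin \o xi n).

Let integrable_xi B n : measurable B -> P.-integrable B (EFin \o xi n).
Proof. by move=> mB; apply: (integrableS measurableT) (xi_int n). Qed.

Lemma exchangeable_integral_xi i j B : exchangeable_sigma xi B ->
  (\int[P]_(w in B) (xi i w)%:E = \int[P]_(w in B) (xi j w)%:E)%E.
Proof.
move=> EB; have mB := exchangeable_sigma_sub EB.
have := exchangeable_integral (f := @coordinate R j) (p := transpose_nat i j)
  xi_exch (finite_perm_transpose i j) EB (measurable_coordinate j).
rewrite /coordinate /sample_path /= /transpose_nat eqxx.
have -> : (if j == i then j else i) = i by case: eqP.
by apply; exact: integrable_xi.
Qed.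

(** Garsia's inequality for the variables [c * xi (iota i) - b] bounds the
    integral of [c * Y] over [B] from below by [b * P B], whereas [c * Y < a]
    bounds it from above by [a * P B]. The factor [c] is there to be [1] or
    [-1]. *)
Lemma crossing_null (iota : nat -> nat) (j : nat) (c a b : R) Y B :
  injective iota -> a < b -> exchangeable_sigma xi B ->
  P.-integrable B (EFin \o Y) ->
  (\int[P]_(w in B) (Y w)%:E = \int[P]_(w in B) (xi j w)%:E)%E ->
  (forall w, B w -> c * Y w < a /\
    limsup_mean_gt b (fun n => \sum_(0 <= i < n.+1) c * xi (iota i) w)) ->
  P B = 0%E.
Proof.
move=> iota_inj ab EB iY intY BP; have mB := exchangeable_sigma_sub EB.
pose y i w := c * xi (iota i) w - b.
have iB r : P.-integrable B (EFin \o cst r).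
  exact: finite_measure_integrable_cst.
have icxi i : P.-integrable B (EFin \o (fun w => c * xi i w)).
  rewrite (_ : _ \o _ = (fun w => c%:E * (EFin \o xi i) w)%E).
    exact: integrableZl (integrable_xi i mB).
  by apply/funext => w /=; rewrite EFinM.
have iy i : P.-integrable B (EFin \o y i).
  rewrite (_ : _ \o _ = (fun w => (c * xi (iota i) w)%:E - b%:E)%E).
    by apply: integrableB => //; [exact: icxi|exact: (iB b)].
  by apply/funext => w /=; rewrite EFinB.
have y_ge0 : (0 <= \int[P]_(w in B) (y 0%N w)%:E)%E.
  apply: (garsia_inequality (y := y)) => //; last first.
    move=> w /BP[_ [k /(_ 0%N)[n _ ltn]]].
    exists n.+1; rewrite sumrB sumr_const_nat subn0 subr_gt0 -mulr_natl.
    by apply: le_lt_trans ltn; rewrite ler_wpM2l// lerDl invr_ge0.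
  move=> n.
  (* [p] carries the first [n] coordinates along [iota] to their successors,
     and [running_max n] depends on these only. *)
  have [p [fp pE]] := @finite_perm_interpolation iota (iota \o succn)
    iota_inj (inj_comp iota_inj succn_inj) n.
  pose f (x : path_space R) := running_max n (fun i => c * x (iota i) - b).
  have fpE w : f (sample_path (xi \o p) w) =
      running_max n (fun i => y i.+1 w).
    by apply: eq_running_max => i lin; rewrite /y /sample_path /= pE.
  under eq_integral do rewrite -fpE.
  apply: (exchangeable_integral (f := f)) => //.
  - apply: measurable_running_max => i; apply: measurable_funB => //.
    apply: measurable_funM => //; exact: measurable_coordinate.
  - exact: integrable_running_max.
  - rewrite (_ : _ \o _ = (fun w => (running_max n (fun i => y i.+1 w))%:E)).
      exact: (integrable_running_max n mB (fun i => iy i.+1)).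
    by apply/funext => w /=; rewrite fpE.
have lower : b * fine (P B) <= c * \int[P]_(w in B) Y w.
  have -> : \int[P]_(w in B) Y w = \int[P]_(w in B) xi (iota 0%N) w.
    by congr fine; rewrite intY; exact: exchangeable_integral_xi.
  rewrite -subr_ge0 -RintegralZl//; last exact: integrable_xi.
  rewrite -Rintegral_cst// -RintegralB//; last exact: (iB b).
  exact: fine_ge0 y_ge0.
have upper : c * \int[P]_(w in B) Y w <= a * fine (P B).
  rewrite -RintegralZl// -Rintegral_cst//.
  apply: le_Rintegral => // [||w /BP[/ltW]//]; last exact: (iB a).
  rewrite (_ : _ \o _ = (fun w => c%:E * (EFin \o Y) w)%E).
    exact: integrableZl.
  by apply/funext => w /=; rewrite EFinM.
have PB_fin : P B \is a fin_num by exact: fin_num_measure.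
have : (b - a) * fine (P B) <= 0 by rewrite mulrBl subr_le0 (le_trans lower).
rewrite pmulr_rle0 ?subr_gt0// => PB_le0.
rewrite -(fineK PB_fin); congr EFin; apply/eqP.
by rewrite eq_le PB_le0 fine_ge0.
Qed.

(** The crossing event lies in [G]: the condition on [Y] because [Y] is
    measurable for [G], the condition on the means because it is a tail event.
    The latter holds for every injective [iota], which is why the limit [Y] does
    not depend on the order, or on the choice, of the variables averaged. *)
Theorem exchangeable_strong_law (G : set (set T)) (j : nat) (Y : T -> R)
    (iota : nat -> nat) :
  sigma_algebra setT G -> tail_sigma xi `<=` G ->
  G `<=` exchangeable_sigma xi -> is_cond_exp P G (xi j) Y ->
  injective iota -> as_cesaro_cvg P (fun k => xi (iota k)) Y.
Proof.
move=> sG tailG GE [mY iY intY] iota_inj.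
pose crossing (c a b : R) : set T := [set w | c * Y w < a] `&` [set w |
  limsup_mean_gt b (fun n => \sum_(0 <= i < n.+1) c * xi (iota i) w)].
have crossing0 c a b : a < b -> P.-negligible (crossing c a b).
  move=> ab; have GB : G (crossing c a b).
    have mGE : @measurable _ (g_sigma_algebraType G) = G.
      exact: measurable_g_measurableTypeE.
    rewrite -mGE; apply: measurableI; last first.
      by rewrite mGE; apply: tailG; exact: tail_limsup_mean_gt.
    rewrite mGE [X in G X](_ : _ = Y @^-1` [set r | c * r < a])//.
    apply: mY; rewrite -[X in measurable X]setTI.
    have := measurable_fun_ltr (D := setT) (f := fun r : R => c * r)
      (g := cst a) (mulrl_measurable c) (@measurable_cst _ _ _ _ _ _).
    by move=> /(_ measurableT [set true] I).
  have mB := exchangeable_sigma_sub (GE _ GB).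
  apply/negligibleP => //.
  apply: (crossing_null (c := c) iota_inj ab (GE _ GB)) (intY _ GB) _;
    last by move=> w [].
  exact: (integrableS measurableT) iY.
(* The signs and pairs of rationals are numbered by [pickle]. *)
pose null k w := if @unpickle (bool * rat * rat)%type k is Some (s, a, b) then
  a < b -> ~ crossing ((-1) ^+ s) (ratr a) (ratr b) w else True.
have : {ae P, forall w, forall k, null k w}.
  apply: ae_foralln => k; rewrite /null.
  case: unpickle => [[[s q] r]|]; last exact: aeW.
  have [qr|_] := boolP (q < r); last exact: aeW.
  apply: negligibleS (crossing0 ((-1) ^+ s) (ratr q) (ratr r) _).
    by move=> x /= /not_implyP[_ /contrapT].
  by rewrite ltr_rat.
apply: filterS => w nullw; apply: mean_cvg => s a b ab Ya gt_b.
by have := nullw (pickle (s, a, b)); rewrite /null pickleK; apply.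
Qed.

End StrongLaw.

(** * The theorem *)

Local Close Scope ring_scope.
Local Close Scope classical_set_scope.

Theorem theorem1p2 (d : measure_display) (T : measurableType d) (R : realType)
    (P : probability T R) (xi : nat -> {RV P >-> R})
    (xi_exch : exchangeable xi)
    (xi_int : forall n : nat, P.-integrable [set: T]%classic (EFin \o xi n))
    (xibar : T -> R)
    (xibarE : is_cond_exp P (exchangeable_sigma xi) (xi 0) xibar) :
  [/\ forall n pi : nat -> nat,
        {homo n : i j / (i < j)%N} -> bijective pi ->
        as_cesaro_cvg P (fun k => xi (n (pi k))) xibar,
      forall sigma m : nat -> nat,
        bijective sigma -> {homo m : i j / (i < j)%N} ->
        as_cesaro_cvg P (fun k => xi (sigma (m k))) xibar &
      forall (n : nat) (Y Z : T -> R),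
        is_cond_exp P (exchangeable_sigma xi) (xi n) Y ->
        is_cond_exp P (tail_sigma xi) (xi n) Z ->
        {ae P, forall w, xibar w = Y w /\ Y w = Z w}].
Proof.
have incr_inj (m : nat -> nat) : {homo m : i j / (i < j)%N} -> injective m.
  by move=> m_lt i j ij; case: (ltngtP i j) => // /m_lt; rewrite ij ltnn.
have tailE := @tail_sigma_exchangeable _ _ _ _ xi.
have sE := exchangeable_sigma_algebra xi.
have lawE j Y iota : is_cond_exp P (exchangeable_sigma xi) (xi j) Y ->
    injective iota -> as_cesaro_cvg P (fun k => xi (iota k)) Y.
  exact: exchangeable_strong_law.
split=> [n pi /incr_inj n_inj /bij_inj pi_inj
        |sigma m /bij_inj sigma_inj /incr_inj m_inj|n Y Z YE ZT].
- exact: lawE xibarE (inj_comp n_inj pi_inj).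
- exact: lawE xibarE (inj_comp sigma_inj m_inj).
have cvg_xibar := lawE _ _ id xibarE (@inj_id _).
have cvg_Y := lawE _ _ id YE (@inj_id _).
have cvg_Z : as_cesaro_cvg P xi Z.
  have sT := tail_sigma_algebra xi.
  by apply: (exchangeable_strong_law _ _ sT) ZT (@inj_id _).
apply: filterS3 cvg_xibar cvg_Y cvg_Z => w xibar_w Y_w Z_w.
split; first exact: cvg_unique xibar_w Y_w.
exact: cvg_unique Y_w Z_w.
Qed.
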